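(* Let $k,n$ be positive integers with $n>1$, let $d=2k$, $c\in\mathbb{Q}$, and $f_{d,c}(x)=x^d+c$. Suppose $X_1/Z$ and $X_2/Z=f_{d,c}(X_1/Z)$ are rational periodic points of exact period $n$ of $f_{d,c}$, with $c=C/Z^d$, where $X_1,X_2,C,Z$ are integers and $X_1/Z$, $X_2/Z$, $C/Z^d$ are in lowest terms. Then $\gcd(X_1,X_2)=1$. Moreover, if $n=2$, then: (a) $X_1^k+X_2^k=\delta Z_1^{2k-1}$ for some $Z_1\in\mathbb{Z}$ and $\delta\in\{1,2\}$; (b) if $k$ is odd, then $X_1^k+X_2^k=Z_1^{2k-1}$ for some $Z_1\in\mathbb{Z}$.
   Context: A point $P$ is periodic of exact period $n$ for $f$ if $f^n(P)=P$ and $f^m(P)\neq P$ for $0<m<n$, where $f^m$ denotes the $m$-th iterate. *)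

(* Defs.v *)
From mathcomp Require Import all_boot all_order all_algebra.

Set Implicit Arguments.
Unset Strict Implicit.
Unset Printing Implicit Defensive.

Import Order.TTheory GRing.Theory Num.Theory.
Local Open Scope ring_scope.

Definition exact_period (T : Type) (f : T -> T) (n : nat) (P : T) : Prop :=
  [/\ (0 < n)%N,
      iter n f P = P
    & forall m : nat, (0 < m)%N -> (m < n)%N -> iter m f P <> P].

Definition unicritical (d : nat) (c x : rat) : rat := x ^+ d + c.

(* The sign of the denominator [b] is not normalised. *)
Definition lowest_terms (a b : int) : Prop := b <> 0 /\ coprimez a b.

(* Main.v *)
(** Let g = gcd (X1, X2), which is coprime to Z. Then g divides c and every orbit
    point g-locally, so each application of x^d + c multiplies the difference of
    consecutive orbit points by another factor of g; going around the cycle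
    repeatedly, every power of g divides X2 - X1 <> 0, and g = 1.

    For n = 2, subtracting the two equations X2 Z^(d-1) = X1^d + C and
    X1 Z^(d-1) = X2^d + C gives S Q = (- Z)^(2k-1), where S = X1^k + X2^k and
    Q = (X1^k - X2^k) / (X1 - X2). Since gcd (S, Q) divides 2, either S and Q are
    coprime and S is a (2k-1)-th power, or X1 and X2 are odd and k is even
    (Q is congruent to k modulo 2); in the latter case S = 2 modulo 4 and S/2 is
    a (2k-1)-th power. *)

Require Import Defs.
From mathcomp Require Import all_boot all_order all_algebra.
From mathcomp Require Import ring zify.

Set Implicit Arguments.
Unset Strict Implicit.
Unset Printing Implicit Defensive.

Import Order.TTheory GRing.Theory Num.Theory.
Local Open Scope ring_scope.

(** * Divisibility of rationals by powers of [g], up to denominators prime to [g] *)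

(* [g ^ m] divides [q] in the ring of fractions whose denominator is prime to [g]. *)
Definition locdvd (g : int) (m : nat) (q : rat) : Prop :=
  exists a b : int, coprimez b g /\ q * b%:Q = (g ^+ m * a)%:Q.

Lemma locdvd_leq (g : int) (m n : nat) (q : rat) :
  (m <= n)%N -> locdvd g n q -> locdvd g m q.
Proof.
move=> le_mn [a [b [cbg qb]]]; exists (g ^+ (n - m) * a), b; split=> //.
by rewrite qb mulrA -exprD subnKC.
Qed.

Lemma locdvdM (g : int) (m n : nat) (p q : rat) :
  locdvd g m p -> locdvd g n q -> locdvd g (m + n) (p * q).
Proof.
move=> [a [b [cbg pb]]] [a' [b' [cbg' qb']]]; exists (a * a'), (b * b').
by rewrite coprimezMl cbg cbg' intrM mulrACA pb qb' -intrM mulrACA -exprD.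
Qed.

Lemma locdvdN (g : int) (m : nat) (q : rat) :
  locdvd g m q -> locdvd g m (- q).
Proof.
by move=> [a [b [cbg qb]]]; exists (- a), b; rewrite mulrN rmorphN mulNr qb.
Qed.

Lemma locdvdD (g : int) (m : nat) (p q : rat) :
  locdvd g m p -> locdvd g m q -> locdvd g m (p + q).
Proof.
move=> [a [b [cbg pb]]] [a' [b' [cbg' qb']]].
exists (a * b' + a' * b), (b * b'); rewrite coprimezMl cbg cbg'; split=> //.
have -> : (p + q) * (b * b')%:Q = p * b%:Q * b'%:Q + q * b'%:Q * b%:Q.
  by rewrite intrM; ring.
by rewrite pb qb' -!intrM -intrD mulrDr !mulrA.
Qed.

Lemma locdvdX (g : int) (x : rat) (e : nat) :
  locdvd g 1 x -> locdvd g e (x ^+ e).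
Proof.
move=> gx; elim: e => [|e IHe]; last by rewrite exprS; apply: locdvdM gx IHe.
by exists 1, 1; rewrite coprimezE coprime1n !expr0.
Qed.

(** The quotient by [x - y] is a form of degree [e] in [x] and [y], so it contributes [g ^ e]. *)
Lemma locdvd_subX (g : int) (m e : nat) (x y : rat) :
  locdvd g 1 x -> locdvd g 1 y -> locdvd g m (x - y) ->
  locdvd g (m + e) (x ^+ e.+1 - y ^+ e.+1).
Proof.
move=> gx gy gxy; elim: e => [|e IHe]; first by rewrite addn0 !expr1.
have -> : x ^+ e.+2 - y ^+ e.+2
          = x * (x ^+ e.+1 - y ^+ e.+1) + (x - y) * y ^+ e.+1.
  by rewrite (exprS x) (exprS y); ring.
apply: locdvdD; last exact: locdvdM gxy (locdvdX _ gy).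
by rewrite addnS -add1n; apply: locdvdM gx IHe.
Qed.

(** This brings local divisibility back to the integers: the denominator [v] is prime to [g], so
    Gauss's lemma cancels it. *)
Lemma locdvd_frac (g a b : int) (m : nat) :
  b != 0 -> coprimez b g -> (g ^+ m %| a)%Z <-> locdvd g m (a%:Q / b%:Q).
Proof.
move=> b0 cbg; have b0Q : b%:Q != 0 by rewrite intr_eq0.
split=> [/dvdzP[u ->]|[u [v [cvg /eqP]]]].
  by exists u, b; rewrite divfK // mulrC.
rewrite -(inj_eq (mulIf b0Q)) mulrAC divfK // -!intrM.
rewrite (inj_eq intr_inj) => /eqP eq_av.
rewrite -(@Gauss_dvdzl _ _ v) ?eq_av -?mulrA ?dvdz_mulr //.
by rewrite coprimez_sym coprimezXr.
Qed.

(** If [|g| >= 2], the exponent [m = |a|] already gives [|g| ^ m > |a|]; [g = 0] fails at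
    [m = 1]. *)
Lemma absz_eq1_dvdz_exp (g a : int) :
  a != 0 -> (forall m : nat, (g ^+ m %| a)%Z) -> `|g|%N = 1%N.
Proof.
move=> a0 gXa; have a_gt0 : (0 < `|a|)%N by rewrite absz_gt0.
case Eg: `|g|%N => [|[|h]] //.
  by move: (gXa 1%N); rewrite dvdzE abszX Eg dvd0n absz_eq0 (negPf a0).
have := gXa `|a|%N; rewrite dvdzE abszX Eg => /(dvdn_leq a_gt0).
by rewrite leqNgt ltn_expl.
Qed.

Lemma periodic_gcdz_eq1 (d n : nat) (c : rat) (X1 X2 Z : int) :
  (1 < d)%N -> (0 < n)%N -> X1 != X2 -> lowest_terms X1 Z ->
  X2%:Q / Z%:Q = unicritical d c (X1%:Q / Z%:Q) ->
  iter n (unicritical d c) (X1%:Q / Z%:Q) = X1%:Q / Z%:Q ->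
  gcdz X1 X2 = 1.
Proof.
move=> d_gt1 n_gt0 neqX [/eqP Z0 cXZ] hf hP; set g := gcdz X1 X2.
have cZg : coprimez Z g.
  by rewrite coprimez_sym; apply: (coprimez_dvdl _ cXZ); exact: dvdz_gcdl.
have dvd1 : locdvd g 1 (X1%:Q / Z%:Q).
  by apply/locdvd_frac; rewrite ?expr1 ?dvdz_gcdl.
have dvd2 : locdvd g 1 (X2%:Q / Z%:Q).
  by apply/locdvd_frac; rewrite ?expr1 ?dvdz_gcdr.
set f := unicritical d c in hf hP; set x := X1%:Q / Z%:Q in hf hP dvd1.
have dvdc : locdvd g 1 c.
  have -> : c = X2%:Q / Z%:Q - x ^+ d by rewrite hf /f /unicritical; ring.
  apply: locdvdD dvd2 (locdvdN _).
  exact: locdvd_leq (ltnW d_gt1) (locdvdX _ dvd1).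
have dvd_iter i : locdvd g 1 (iter i f x).
  elim: i => [|i IHi] //=; apply: locdvdD dvdc.
  exact: locdvd_leq (ltnW d_gt1) (locdvdX _ IHi).
have dvd_diff i : locdvd g i (iter i.+1 f x - iter i f x).
  elim: i => [|i IHi].
    (* Exponent 0 is not vacuous: it still asks for a denominator prime to [g]. *)
    by apply: (@locdvd_leq g 0 1) => //; apply: locdvdD (locdvdN _).
  rewrite [iter i.+2 _ _]iterS [X in _ - X]iterS {1 3}/f /unicritical.
  rewrite opprD addrACA subrr addr0 -(ltn_predK d_gt1).
  (* The constant [c] has cancelled; the exponent grows by [d.-1], which is at least 1. *)
  apply: locdvd_leq (locdvd_subX _ (dvd_iter _) (dvd_iter _) IHi).
  by rewrite -addn1 leq_add2l -ltnS (ltn_predK d_gt1).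
have iter_mul m : iter (m * n) f x = x.
  by elim: m => [|m IHm] //; rewrite mulSn iterD IHm.
have gXdvd m : (g ^+ m %| X2 - X1)%Z.
  apply/(locdvd_frac _ _ Z0 cZg); rewrite intrB mulrBl hf -/x.
  (* After [m * n >= m] steps the orbit is back at [x], so the difference there is again the initial
     one. *)
  apply: (@locdvd_leq _ _ (m * n)); first exact: leq_pmulr.
  by have := dvd_diff (m * n)%N; rewrite iterS iter_mul.
have := absz_eq1_dvdz_exp _ gXdvd.
by rewrite subr_eq0 eq_sym => /(_ neqX) g1; rewrite -[g]gez0_abs ?g1.
Qed.

(** * Coprime factors of perfect powers, and parity *)

Lemma coprime_mul_expn (a b z m : nat) :
  coprime a b -> (a * b = z ^ m)%N -> (0 < m)%N -> exists w, a = (w ^ m)%N.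
Proof.
move=> cab eq_ab m_gt0; have [a0|a_gt0] := posnP a.
  by exists 0%N; rewrite a0 exp0n.
(* The root is [gcdn a z]: its [m]-th power is gcd(a^m, z^m) = gcd(a^m, a b) = a gcd(a^(m-1), b) =
   a. *)
have g_gt0 : (0 < gcdn a z)%N by rewrite gcdn_gt0 a_gt0.
exists (gcdn a z); transitivity (gcdn (a ^ m) (z ^ m)).
  rewrite -eq_ab -(prednK m_gt0) expnS -muln_gcdr.
  by have /eqP -> := coprimeXl m.-1 cab; rewrite muln1.
set g := gcdn a z in g_gt0 *.
have [eq_a eq_z] : a = (g * (a %/ g))%N /\ z = (g * (z %/ g))%N.
  by split; rewrite mulnC divnK ?dvdn_gcdl ?dvdn_gcdr.
have cq : coprime (a %/ g) (z %/ g).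
  by rewrite /coprime -(eqn_pmul2l g_gt0) muln_gcdr -eq_a -eq_z muln1.
rewrite [in LHS]eq_a [in LHS]eq_z !expnMn -muln_gcdr.
by have /eqP -> := coprimeXl m (coprimeXr m cq); rewrite muln1.
Qed.

(** An odd exponent lets the sign of [a] be absorbed into the root. *)
Lemma coprimez_mul_odd_exp (a b z : int) (m : nat) :
  odd m -> coprimez a b -> a * b = z ^+ m -> exists w : int, a = w ^+ m.
Proof.
move=> odd_m cab eq_ab; have m_gt0 : (0 < m)%N by case: (m) odd_m.
have := congr1 absz eq_ab; rewrite abszM abszX => eq_abn.
have [w eq_w] := coprime_mul_expn cab eq_abn m_gt0.
have := intEsign a; rewrite eq_w => ->.
exists ((-1) ^+ (a < 0)%R * w%:Z); rewrite exprMn -exprM mulnC exprM.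
by rewrite -[(-1) ^+ m]signr_odd odd_m expr1 -[(w ^ m)%N%:Z]natz natrX natz.
Qed.

Lemma odd_abszM (a b : int) : odd `|(a * b)%R|%N = odd `|a|%N && odd `|b|%N.
Proof. by rewrite abszM oddM. Qed.

Lemma odd_abszX (a : int) (n : nat) :
  odd `|a|%N -> odd `|(a ^+ n)%R|%N.
Proof. by rewrite abszX oddX => ->; rewrite orbT. Qed.

Lemma odd_abszD (a b : int) : odd `|(a + b)%R|%N = odd `|a|%N (+) odd `|b|%N.
Proof. lia. Qed.

Lemma odd_absz_sum (n : nat) (F : 'I_n -> int) :
  (forall i, odd `|F i|%N) -> odd `|(\sum_(i < n) F i)%R|%N = odd n.
Proof.
elim: n F => [|n IHn] F oddF; first by rewrite big_ord0.
by rewrite big_ord_recr odd_abszD oddF IHn //= addbT.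
Qed.

Lemma odd_abszP (a : int) : odd `|a|%N -> exists u : int, a = 2 * u + 1.
Proof. move=> odd_a; exists (a %/ 2)%Z; lia. Qed.

Lemma coprimez_dvd2 (a b : int) :
  (gcdz a b %| 2)%Z -> odd `|a|%N || odd `|b|%N -> coprimez a b.
Proof.
move=> g2 odd_ab; rewrite /coprimez.
have odd_g : odd `|gcdz a b|%N.
  case/orP: odd_ab; apply: dvdn_odd; rewrite -dvdzE.
    exact: dvdz_gcdl.
  exact: dvdz_gcdr.
have := dvdn_leq (isT : 0 < 2)%N g2.
rewrite /gcdz /= in odd_g *.
by case: (gcdn _ _) odd_g => [|[|[|]]].
Qed.

Lemma gcdz_sumX_dvd2 (x y s : int) (k : nat) :
  coprimez x y -> (s %| x ^+ k + y ^+ k)%Z -> (s %| x ^+ k - y ^+ k)%Z ->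
  (s %| 2)%Z.
Proof.
move=> cxy sD sB.
have /coprimezP[[u v] /= uv1] : coprimez (x ^+ k) (y ^+ k).
  by rewrite coprimezXl ?coprimezXr.
(* A Bezout relation for the [k]-th powers, doubled and rewritten in their sum and difference. *)
have -> : 2%Z = (u + v) * (x ^+ k + y ^+ k) + (u - v) * (x ^+ k - y ^+ k).
  by rewrite -[2%Z]mulr1 -uv1; ring.
by rewrite rpredD // dvdz_mull.
Qed.

Lemma sumX_eq_exp (x y z : int) (k : nat) :
  (0 < k)%N -> x != y -> coprimez x y ->
  x ^+ (2 * k) - y ^+ (2 * k) = (x - y) * z ^+ (2 * k - 1) ->
  (exists (w delta : int), (delta = 1 \/ delta = 2) /\
     x ^+ k + y ^+ k = delta * w ^+ (2 * k - 1)) /\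
  (odd k -> exists w : int, x ^+ k + y ^+ k = w ^+ (2 * k - 1)).
Proof.
move=> k_gt0 neq_xy cxy eq_xyz; set S := x ^+ k + y ^+ k.
have odd_m : odd (2 * k - 1) by lia.
pose Q := \sum_(i < k) x ^+ (k.-1 - i) * y ^+ i.
have eqQ : x ^+ k - y ^+ k = (x - y) * Q := subrXX x y k.
have eqSQ : S * Q = z ^+ (2 * k - 1).
  have xy0 : x - y != 0 by rewrite subr_eq0.
  by apply: (mulfI xy0); rewrite -eq_xyz mulrCA -eqQ mulrC mulnC !exprM -subr_sqr.
have dvd2 s : (s %| S)%Z -> (s %| Q)%Z -> (s %| 2)%Z.
  by move=> sS sQ; apply: (gcdz_sumX_dvd2 cxy sS); rewrite eqQ dvdz_mull.
have [odd_SQ|] := boolP (odd `|S|%N || odd `|Q|%N).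
  have cSQ : coprimez S Q.
    by apply: coprimez_dvd2 odd_SQ; rewrite dvd2 ?dvdz_gcdl ?dvdz_gcdr.
  have [w eqS] := coprimez_mul_odd_exp odd_m cSQ eqSQ.
  by split=> [|_]; [exists w, 1; rewrite mul1r; split; first by left|exists w].
rewrite negb_or => /andP[evenS evenQ].
have eq_parity : odd `|x|%N = odd `|y|%N.
  by move: evenS; rewrite odd_abszD !abszX !oddX eqn0Ngt k_gt0 /=; do 2!case: odd.
have odd_x : odd `|x|%N.
  apply/negPn/negP => even_x; have even_y : ~~ odd `|y|%N by rewrite -eq_parity.
  have : (2 %| gcdn `|x| `|y|)%N by rewrite dvdn_gcd !dvdn2 even_x.
  by move/eqP: (cxy) => [->].
have odd_y : odd `|y|%N by rewrite -eq_parity.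
have even_k : ~~ odd k.
  (* [Q] is a sum of [k] odd terms and is even. *)
  rewrite -(@odd_absz_sum k (fun i => x ^+ (k.-1 - i) * y ^+ i)) // => i.
  by rewrite odd_abszM !odd_abszX.
split; last by rewrite (negPf even_k).
have [u eq_u] := odd_abszP (odd_abszX k./2 odd_x).
have [v eq_v] := odd_abszP (odd_abszX k./2 odd_y).
(* As [k] is even, [S] is the sum of the odd squares [(2u+1)^2] and [(2v+1)^2], hence twice an odd
   number. *)
pose T := 2 * (u ^+ 2 + u + v ^+ 2 + v) + 1.
have eqST : S = 2 * T.
  rewrite /S -(even_halfK even_k) -muln2 !exprM eq_u eq_v /T; ring.
have odd_T : odd `|T|%N by rewrite odd_abszD odd_abszM.
(* Moving the factor 2 from [S] to [Q] leaves coprime factors with the same product. *)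
have cTQ : coprimez T (2 * Q).
  rewrite coprimezMr; apply/andP; split.
    by rewrite coprimezE coprimen2.
  apply: coprimez_dvd2; last by rewrite odd_T.
  by rewrite dvd2 ?dvdz_gcdr // eqST dvdz_mull ?dvdz_gcdl.
have eqTQ : T * (2 * Q) = z ^+ (2 * k - 1) by rewrite -eqSQ eqST; ring.
have [w eqT] := coprimez_mul_odd_exp odd_m cTQ eqTQ.
by exists w, 2; split; [right|rewrite eqST eqT].
Qed.

Theorem theorem3p3 (k n d : nat) (c : rat) (X1 X2 C Z : int)
  (hk : (0 < k)%N) (hn : (1 < n)%N) (hd : d = (2 * k)%N)
  (hX1 : lowest_terms X1 Z) (hX2 : lowest_terms X2 Z)
  (hC : lowest_terms C (Z ^+ d))
  (hc : c = C%:Q / (Z ^+ d)%:Q)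
  (hf : X2%:Q / Z%:Q = unicritical d c (X1%:Q / Z%:Q))
  (hP1 : exact_period (unicritical d c) n (X1%:Q / Z%:Q))
  (hP2 : exact_period (unicritical d c) n (X2%:Q / Z%:Q)) :
  gcdz X1 X2 = 1 /\
  (n = 2%N ->
     (exists (Z1 delta : int),
        (delta = 1 \/ delta = 2) /\
        X1 ^+ k + X2 ^+ k = delta * Z1 ^+ (2 * k - 1)) /\
     (odd k ->
        exists Z1 : int, X1 ^+ k + X2 ^+ k = Z1 ^+ (2 * k - 1))).
Proof.
have [n_gt0 iter_n iter_lt] := hP1.
have neqX : X1 != X2.
  (* Equality would make [X1 / Z] a fixed point, against exact period [n > 1]. *)
  apply/eqP => eqX; apply: (iter_lt 1%N) => //=.
  by rewrite -hf eqX.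
have d_gt1 : (1 < d)%N by lia.
have gcd1 : gcdz X1 X2 = 1 := periodic_gcdz_eq1 d_gt1 n_gt0 neqX hX1 hf iter_n.
split=> // n2; have hb : X1%:Q / Z%:Q = unicritical d c (X2%:Q / Z%:Q).
  by rewrite hf -[LHS]iter_n n2.
(* Since [f] swaps the two points, their difference changes sign; as [d - 1] is odd, replacing [Z]
   by [- Z] absorbs it. *)
apply: (@sumX_eq_exp _ _ (- Z)) => //; first by rewrite /coprimez gcd1.
have Z0 : Z%:Q != 0 by rewrite intr_eq0; apply/eqP; case: hX1.
have eqQ : X1%:Q ^+ d - X2%:Q ^+ d = (X2%:Q - X1%:Q) * Z%:Q ^+ d.-1.
  have eq_diff : X2%:Q / Z%:Q - X1%:Q / Z%:Q
                 = (X1%:Q / Z%:Q) ^+ d - (X2%:Q / Z%:Q) ^+ d.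
    have /= -> := congr2 (fun u v => u - v) hf hb.
    by rewrite /unicritical; ring.
  rewrite !expr_div_n -!mulrBl in eq_diff.
  apply: (mulIf (invr_neq0 (expf_neq0 d Z0))); rewrite -eq_diff.
  by rewrite -{2}(ltn_predK d_gt1) exprS; field; rewrite Z0 expf_neq0.
apply: (@intr_inj rat); rewrite -hd subn1 exprNn.
have -> : (-1) ^+ d.-1 = -1 :> int.
  by rewrite -signr_odd; have -> : odd d.-1 by lia.
by rewrite intrM !intrB !rmorphXn /= eqQ intrM rmorphXn /=; ring.
Qed.
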